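(* Let $M_{\chi}$ be the triangular cut on graphons, $M_\chi(w) = w\chi$. Then for all $c > 0$ there exists a graphon $w \in \mathcal{W}^{\infty}$ such that $\|M_{\chi}(w)\|_{\Box} > c\,\|w\|_{\Box}$; in other words, $\|M_{\chi}\|_{\mathrm{opr}} = \infty$ on the space $(\mathcal{W}^{\infty}, \|\cdot\|_{\Box})$. Furthermore, for every $1 \leq p < \infty$, $M_{\chi}$ acting on $(\mathcal{W}^p, \|\cdot\|_{\Box})$ is also an unbounded operator.
   Context: For $1 \leq p \leq \infty$, an $L^p$ graphon is a symmetric measurable function $w \in L^p([0,1]^2)$ (real-valued, $w(x,y) = w(y,x)$), and $\mathcal{W}^p$ denotes the linear space of $L^p$ graphons; in particular $\mathcal{W}^\infty$ consists of the bounded symmetric measurable functions on $[0,1]^2$. For $w \in L^1([0,1]^2)$ (not necessarily symmetric), the cut norm is $$\|w\|_{\Box} = \sup_{S,T \subseteq [0,1]} \Big| \int_{S \times T} w(x,y)\,dx\,dy \Big|,$$ the supremum being over all measurable subsets $S,T$ of $[0,1]$. Let $\chi : [0,1]^2 \to [0,1]$ be given by $\chi(x,y) = 1$ if $x \leq y$ and $\chi(x,y) = 0$ if $x > y$. The triangular cut on graphons is the linear operator $M_{\chi} : \mathcal{W}^p \to L^p([0,1]^2)$, $w \mapsto w\chi$ (pointwise product). Its domain and codomain are both equipped with the cut norm, and $\|M_\chi\|_{\mathrm{opr}}$ is the corresponding operator norm; unbounded means this norm is infinite. *)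

(* Defs.v *)
From HB Require Import structures.
From mathcomp Require Import all_boot all_order all_algebra.
From mathcomp Require Import all_classical all_reals all_analysis.
Set Implicit Arguments.
Unset Strict Implicit.
Unset Printing Implicit Defensive.
Import Order.TTheory GRing.Theory Num.Theory.
Local Open Scope classical_set_scope.
Local Open Scope ring_scope.

Definition unit_square (R : realType) : set (R * R) := `[0, 1] `*` `[0, 1].

Definition lebesgue2 (R : realType) :
    {measure set (measurableTypeR R * measurableTypeR R) -> \bar R} :=
  ((@lebesgue_measure R) \x (@lebesgue_measure R))%E.

(* A function on [0,1]^2 is represented by a total function on R * R whose
   values off the unit square are irrelevant: [w \_ (unit_square R)] is its
   extension by zero.  The exponent [p] ranges over [1, +oo]; for [p = +oo]
   the norm in [Lfun] is the essential supremum. *)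
Definition Lp_square (R : realType) (p : \bar R) : set (R * R -> R) :=
  [set w | (w \_ (@unit_square R)) \in Lfun (@lebesgue2 R) p].

Definition graphon (R : realType) (p : \bar R) : set (R * R -> R) :=
  [set w | Lp_square p w /\
    forall x y : R, x \in `[0, 1] -> y \in `[0, 1] -> w (x, y) = w (y, x)].

Definition cutnorm (R : realType) (w : R * R -> R) : \bar R :=
  ereal_sup [set r : \bar R | exists S T : set (measurableTypeR R),
    [/\ measurable S, measurable T, S `<=` `[0, 1], T `<=` `[0, 1] &
      r = `| \int[@lebesgue2 R]_(z in S `*` T) (w z)%:E |%E]].

Definition tri (R : realType) (z : R * R) : R := if z.1 <= z.2 then 1 else 0.

Definition triangular_cut (R : realType) (w : R * R -> R) : R * R -> R :=
  w \* @tri R.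

(* Operator norm of [M], defined on [V], with domain and codomain both
   equipped with the (possibly infinite) norm [N]. *)
Definition oprnorm (R : realType) (V : set (R * R -> R))
    (N : (R * R -> R) -> \bar R) (M : (R * R -> R) -> (R * R -> R)) : \bar R :=
  ereal_sup [set N (M w) | w in [set w | V w /\ (N w <= 1)%E]].

(* Main.v *)
Require Import Defs.
From HB Require Import structures.
From mathcomp Require Import all_boot all_order all_algebra.
From mathcomp Require Import all_classical all_reals all_analysis.
From mathcomp Require Import measurable_realfun ess_sup_inf ring lra.
Import Order.TTheory GRing.Theory Num.Theory.
Local Open Scope classical_set_scope.
Local Open Scope ring_scope.

(** The triangular cut is unbounded for the same reason as the triangular
truncation of matrices: a kernel that is antisymmetric about the diagonal can
have enormous cancellation, all of which is lost when one half is removed.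

Split [0,1[ dyadically.  To a dyadic interval of length l with halves L and R
attach the kernel l^-1 (1_L(x) 1_R(y) - 1_R(x) 1_L(y)), and let A be the sum
of these kernels over all dyadic intervals of the first n levels.  Above the
diagonal A is nonnegative, and every level contributes the same positive
amount to its integral, so cutting yields cut norm of order n.  Without the
cut, write f and g for the measures of S and T as functions of the interval.
Then
  f(L) g(R) - f(R) g(L)
    = ((f(L) + f(R)) (g(R) - g(L)) - (f(R) - f(L)) (g(L) + g(R))) / 2,
which sees only the differences of f and g between the two halves of an
interval.  Since
  f(L)^2 + f(R)^2 = ((f(L) + f(R))^2 + (f(R) - f(L))^2) / 2,
the squares of these differences, suitably normalised, telescope along the
levels and their total is at most 1 (a martingale difference identity).  By
the inequality between arithmetic and geometric means, n levels therefore
integrate to O(sqrt n) over any S x T: [cross_le] is one step,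
[rect_form_upper_le] is the telescoped bound.

A graphon must be symmetric whereas A is antisymmetric.  Both defects cancel
after multiplication by 1_E(x) 1_O(y) - 1_O(x) 1_E(y), where E and O are two
interleaved sets, each filling half of every dyadic interval that occurs (the
two teeth of a comb).  The cut norm at most doubles, and testing the cut
kernel on E x O still gives n / 16 ([rect_form_upper_comb]).  With n = m^2 the
cut norm is at most 2 m before and at least m^2 / 16 after the cut, so
rescaling gives graphons of cut norm at most 1 whose triangular cuts are
arbitrarily large ([unbounded_graphon]).  They are bounded, hence lie in every
L^p, and all claims follow. *)

(** * Rectangle sums and the dyadic kernel *)

(** The colour b of the interval [a, a + l[ cut into 2 ^ n equal cells: colour
[false] takes the left half of each cell (the set E), colour [true] the right
half (the set O). *)
Fixpoint comb {R : realType} (b : bool) (n : nat) (a l : R) : set R :=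
  if n is n'.+1 then comb b n' a (l / 2) `|` comb b n' (a + l / 2) (l / 2)
  else `[a + b%:R * (l / 2), a + b%:R * (l / 2) + l / 2[.

(** The part of the kernel above the diagonal, as a list of weighted rectangles
(c, A, B) standing for c 1_A(x) 1_B(y).  With L and R the two halves of an
interval of length l, its level adds l^-1 (1_{E in L} 1_{O in R} -
1_{O in L} 1_{E in R}).  The part below the diagonal is the transpose. *)
Fixpoint upper {R : realType} (n : nat) (a l : R) : seq (R * set R * set R) :=
  if n is n'.+1 then
    upper n' a (l / 2) ++ upper n' (a + l / 2) (l / 2) ++
    [:: (l^-1, comb false n' a (l / 2), comb true n' (a + l / 2) (l / 2));
        (- l^-1, comb true n' a (l / 2), comb false n' (a + l / 2) (l / 2))]
  else [::].

Definition rect_sum {R : realType} (s : seq (R * set R * set R)) (z : R * R) : R :=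
  \sum_(u <- s) u.1.1 * (\1_(u.1.2) z.1 * \1_(u.2) z.2).

Definition rect_form {R : realType} (s : seq (R * set R * set R))
    (f g : set R -> R) : R :=
  \sum_(u <- s) u.1.1 * (f u.1.2 * g u.2).

Definition transpose {R : realType} (s : seq (R * set R * set R)) :=
  [seq (u.1.1, u.2, u.1.2) | u <- s].

(** Integrating c 1_A(x) 1_B(y) over S x T gives c [mass_in S A] [mass_in T B], so
the integral of a rectangle sum is its [rect_form] at these two functions. *)
Definition mass_in {R : realType} (S A : set R) : R :=
  fine (@lebesgue_measure R (A `&` S)).

Definition measurable_rects {R : realType} (s : seq (R * set R * set R)) :=
  forall u, u \in s -> measurable (u.1.2 : set (measurableTypeR R)) /\
                       measurable (u.2 : set (measurableTypeR R)).

Lemma rect_sum_cat (R : realType) (s s' : seq (R * set R * set R)) z :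
  rect_sum (s ++ s') z = rect_sum s z + rect_sum s' z.
Proof. by rewrite /rect_sum big_cat. Qed.

Lemma rect_form_cat (R : realType) (s s' : seq (R * set R * set R)) f g :
  rect_form (s ++ s') f g = rect_form s f g + rect_form s' f g.
Proof. by rewrite /rect_form big_cat. Qed.

Lemma rect_sum_transpose (R : realType) (s : seq (R * set R * set R)) x y :
  rect_sum (transpose s) (x, y) = rect_sum s (y, x).
Proof.
by rewrite /rect_sum big_map; apply: eq_bigr => u _ /=; rewrite [\1__ x * _]mulrC.
Qed.

Lemma rect_sum_symmetrized (R : realType) (s : seq (R * set R * set R)) x y :
  rect_sum (s ++ transpose s) (x, y) = rect_sum s (x, y) + rect_sum s (y, x).
Proof. by rewrite rect_sum_cat rect_sum_transpose. Qed.

Lemma rect_form_symmetrized (R : realType) (s : seq (R * set R * set R)) f g :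
  rect_form (s ++ transpose s) f g = rect_form s f g + rect_form s g f.
Proof.
rewrite rect_form_cat; congr (_ + _).
by rewrite /rect_form big_map; apply: eq_bigr => u _ /=; rewrite [f _ * _]mulrC.
Qed.

Lemma comb_sub (R : realType) b n (a l : R) : 0 <= l ->
  comb b n a l `<=` `[a, a + l[.
Proof.
elim: n a l => [|n IH] a l l0 x /=.
  by case: b; rewrite !in_itv/= => /andP[h1 h2]; apply/andP; split; lra.
have l20 : 0 <= l / 2 by lra.
by case=> /(IH _ _ l20) /=; rewrite !in_itv/= => /andP[h1 h2]; apply/andP; split; lra.
Qed.

Lemma comb_measurable (R : realType) b n (a l : R) :
  measurable (comb b n a l : set (measurableTypeR R)).
Proof.
elim: n a l => [|n IH] a l /=; first exact: measurable_itv.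
by apply: measurableU; exact: IH.
Qed.

Lemma comb_halves_disjoint (R : realType) b c n (a l : R) : 0 <= l ->
  comb b n a (l / 2) `&` comb c n (a + l / 2) (l / 2) = set0.
Proof.
move=> l0; have l20 : 0 <= l / 2 by lra.
apply/seteqP; split => // x [/(comb_sub _ _ _ _ _ l20)] /= + /(comb_sub _ _ _ _ _ l20) /=.
by rewrite !in_itv/= => /andP[_ h1] /andP[h2 _]; lra.
Qed.

Lemma comb_colours_disjoint (R : realType) n (a l : R) : 0 <= l ->
  comb false n a l `&` comb true n a l = set0.
Proof.
elim: n a l => [|n IH] a l l0 /=.
  by apply/seteqP; split => // x /=; rewrite !in_itv/= => -[/andP[_ h1] /andP[h2 _]]; lra.
have l20 : 0 <= l / 2 by lra.
rewrite setIUl !setIUr !IH// comb_halves_disjoint//.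
by rewrite [X in _ `|` (X `|` _)]setIC comb_halves_disjoint// !setU0.
Qed.

Lemma comb_measure (R : realType) b n (a l : R) : 0 <= l ->
  @lebesgue_measure R (comb b n a l) = (l / 2)%:E.
Proof.
elim: n a l => [|n IH] a l l0 /=.
  rewrite lebesgue_measure_itv/= lte_fin ltrDl.
  case: ltP => h; first by rewrite -EFinD; congr EFin; ring.
  by congr EFin; lra.
have l20 : 0 <= l / 2 by lra.
rewrite measureU; [|exact: comb_measurable|exact: comb_measurable|exact: comb_halves_disjoint].
apply: etrans (congr2 (fun x y => (x + y)%E) (IH a _ l20) (IH (a + l / 2) _ l20)) _.
by rewrite -EFinD; congr EFin; field.
Qed.

Lemma upper_measurable (R : realType) n (a l : R) :
  measurable_rects (upper n a l).
Proof.
elim: n a l => [//|n IH] a l u /=.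
rewrite !mem_cat !inE => /or3P[/IH//|/IH//|/orP[]/eqP->];
  by split; exact: comb_measurable.
Qed.

Lemma upper_ordered (R : realType) n (a l : R) u x y : 0 <= l ->
  u \in upper n a l -> u.1.2 x -> u.2 y -> x < y.
Proof.
elim: n a l => [//|n IH] a l l0 /=; have l20 : 0 <= l / 2 by lra.
rewrite !mem_cat !inE => /or3P[/(IH _ _ l20)//|/(IH _ _ l20)//|/orP[]/eqP-> /=];
  move=> /(comb_sub _ _ _ _ _ l20) /= + /(comb_sub _ _ _ _ _ l20) /=;
  by rewrite !in_itv/= => /andP[_ h1] /andP[h2 _]; lra.
Qed.

(** Every rectangle of [upper] lies strictly above the diagonal, so the cut keeps
the list and removes its transpose. *)
Lemma triangular_cut_upper (R : realType) n (a l k : R) : 0 <= l ->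
  triangular_cut (fun z => k * rect_sum (upper n a l ++ transpose (upper n a l)) z) =
  (fun z => k * rect_sum (upper n a l) z).
Proof.
move=> l0; apply/funext => -[x y].
rewrite /triangular_cut /= rect_sum_symmetrized /tri /=.
have rect_sum0 x' y' : y' <= x' -> rect_sum (upper n a l) (x', y') = 0.
  move=> yx; rewrite /rect_sum big_seq big1// => u uU /=; rewrite !indicE.
  case: (boolP (x' \in u.1.2)) => [|_]; last by rewrite mul0r mulr0.
  case: (boolP (y' \in u.2)) => [|_]; last by rewrite !mulr0.
  rewrite !inE => yB xA.
  by have := upper_ordered _ _ _ _ _ _ _ l0 uU xA yB; rewrite ltNge yx.
have [xy|/ltW yx] := leP x y; first by rewrite (rect_sum0 y x)// addr0 mulr1.
by rewrite (rect_sum0 x y)// !mulr0.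
Qed.

(** * Integrals of rectangle sums *)

Lemma indic_setX (R : realType) (A B : set R) (z : R * R) :
  \1_(A `*` B) z = \1_A z.1 * \1_B z.2 :> R.
Proof. by case: z => x y; rewrite !indicE in_setX/= -natrM mulnb. Qed.

Lemma rect_sum_measurable (R : realType) (s : seq (R * set R * set R)) :
  measurable_rects s ->
  measurable_fun [set: measurableTypeR R * measurableTypeR R] (rect_sum s).
Proof.
elim: s => [|u s IH] ms.
  rewrite (_ : rect_sum [::] = cst 0); first exact: measurable_cst.
  by apply/funext => z; rewrite /rect_sum big_nil.
rewrite (_ : rect_sum (u :: s) = (fun z => u.1.1 * \1_(u.1.2 `*` u.2) z) \+ rect_sum s).
  have [mA mB] := ms u (mem_head _ _).
  apply: measurable_funD; last by apply: IH => v vs; apply: ms; rewrite inE vs orbT.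
  by apply: measurable_funM => //; apply: measurable_indic; exact: measurableX.
by apply/funext => z; rewrite /rect_sum big_cons/= indic_setX.
Qed.

Lemma rect_sum_bounded (R : realType) (s : seq (R * set R * set R)) :
  exists C : R, forall z, `|rect_sum s z| <= C.
Proof.
exists (\sum_(u <- s) `|u.1.1|) => z.
rewrite /rect_sum (le_trans (ler_norm_sum _ _ _))// ler_sum// => u _.
rewrite normrM ler_piMr// !indicE normrM.
by case: (_ \in _); case: (_ \in _); rewrite ?normr0 ?normr1 ?mulr0 ?mul0r ?mulr1.
Qed.

Lemma lebesgue_unit_fin (R : realType) (S : set (measurableTypeR R)) :
  measurable S -> S `<=` `[0, 1] -> @lebesgue_measure R S \is a fin_num.
Proof.
move=> mS S01; rewrite ge0_fin_numE ?measure_ge0//.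
apply: (@le_lt_trans _ _ (@lebesgue_measure R `[0, 1])).
  by apply: le_measure => //; rewrite inE; [exact: mS|exact: measurable_itv].
by rewrite lebesgue_measure_itv/= lte01 -EFinD ltry.
Qed.

Lemma lebesgue2X (R : realType) (S T : set (measurableTypeR R)) :
  measurable S -> measurable T ->
  @lebesgue2 R (S `*` T) = (@lebesgue_measure R S * @lebesgue_measure R T)%E.
Proof. by move=> mS mT; exact: product_measure1E. Qed.

Lemma rect_sum_integrable (R : realType) (S T : set (measurableTypeR R)) s (k : R) :
  measurable_rects s ->
  measurable S -> measurable T -> S `<=` `[0, 1] -> T `<=` `[0, 1] ->
  (@lebesgue2 R).-integrable (S `*` T) (fun z => (k * rect_sum s z)%:E).
Proof.
move=> ms mS mT S01 T01; apply: measurable_bounded_integrable.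
- exact: measurableX.
- rewrite [X in (X < _)%E]lebesgue2X//.
  rewrite -ge0_fin_numE ?mule_ge0 ?measure_ge0//.
  by rewrite fin_numM// lebesgue_unit_fin.
- apply: measurable_funM => //; apply: measurable_funTS; exact: rect_sum_measurable.
- have [C sC] := rect_sum_bounded _ s.
  exists (`|k| * C); split; rewrite ?num_real// => x Cx z _ /=.
  by rewrite normrM (le_trans _ (ltW Cx))// ler_wpM2l.
Qed.

Lemma rect_sum_integral (R : realType) (S T : set (measurableTypeR R)) s (k : R) :
  measurable_rects s ->
  measurable S -> measurable T -> S `<=` `[0, 1] -> T `<=` `[0, 1] ->
  (\int[@lebesgue2 R]_(z in S `*` T) (k * rect_sum s z)%:E)%E =
  (k * rect_form s (mass_in S) (mass_in T))%:E.
Proof.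
move=> ms mS mT S01 T01; elim: s ms => [|u s IH] ms.
  rewrite /rect_form big_nil mulr0; under eq_integral do rewrite /rect_sum big_nil mulr0.
  by rewrite integral0.
have [mA mB] := ms u (mem_head _ _).
have ms' : measurable_rects s by move=> v vs; apply: ms; rewrite inE vs orbT.
have msu : measurable_rects [:: u] by move=> v; rewrite inE => /eqP->.
have mST : measurable (S `*` T) by exact: measurableX.
have mAB : measurable (u.1.2 `*` u.2 : set (measurableTypeR R * measurableTypeR R)).
  exact: measurableX.
rewrite -cat1s rect_form_cat mulrDr.
under eq_integral do rewrite rect_sum_cat mulrDr EFinD.
rewrite integralD//; [|exact: rect_sum_integrable..].
rewrite IH// EFinD; congr (_ + _)%E.
rewrite /rect_form big_seq1.
rewrite (_ : (fun z => _) = (fun z => (k * u.1.1)%:E * (\1_(u.1.2 `*` u.2) z)%:E)%E); last first.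
  by apply/funext => z; rewrite /rect_sum big_seq1 indic_setX -EFinM mulrA.
rewrite integralZl//; last first.
  have := rect_sum_integrable _ S T [:: (1, u.1.2, u.2)] 1 _ mS mT S01 T01.
  rewrite (_ : (fun z => _) = (fun z => (\1_(u.1.2 `*` u.2) z)%:E)); first apply.
    by move=> v; rewrite inE => /eqP->.
  by apply/funext => z; rewrite /rect_sum big_seq1/= !mul1r indic_setX.
rewrite integral_indic// -setXI.
rewrite [X in (_ * X)%E]lebesgue2X; [|exact: measurableI..].
rewrite [in RHS]mulrA [in RHS]EFinM; congr (_ * _)%E.
rewrite /mass_in EFinM !fineK//; apply: lebesgue_unit_fin.
- exact: measurableI.
- by move=> x [_ /T01].
- exact: measurableI.
- by move=> x [_ /S01].
Qed.

(** The unit square has finite measure, so boundedness suffices for every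
exponent at once. *)
Lemma bounded_graphon (R : realType) (p : \bar R) (f : R * R -> R) (C : R) :
  (1 <= p)%E ->
  measurable_fun [set: measurableTypeR R * measurableTypeR R] f ->
  (forall z, `|f z| <= C) -> (forall x y, f (x, y) = f (y, x)) -> graphon p f.
Proof.
move=> p1 mf fC fsym; split=> [|x y _ _ //].
have mD : measurable (@unit_square R : set (measurableTypeR R * measurableTypeR R)).
  by apply: measurableX; exact: measurable_itv.
(* The default value off the square is the canonical point of R, that is 0. *)
pose fD : R * R -> R := patch (fun=> 0) (@unit_square R) f.
have mfD : measurable_fun [set: measurableTypeR R * measurableTypeR R] fD.
  by apply/(measurable_restrictT _ mD); exact: measurable_funTS.
have C0 : 0 <= C by rewrite (le_trans _ (fC (0, 0))).
have fDC z : `|fD z| <= C.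
  by rewrite /fD patchE; case: ifP => // _; rewrite normr0.
suff : fD \in Lfun (@lebesgue2 R) p by [].
rewrite inE; apply/andP; split; rewrite inE//=.
rewrite /finite_norm unlock /Lnorm.
case: p p1 => [p|_|//]; last first.
  case: ifPn => [_|_]; last by rewrite ltry.
  apply: (@le_lt_trans _ _ C%:E); last by rewrite ltry.
  by apply/ess_supP/nearW => z /=; rewrite lee_fin.
rewrite lee_fin => p1.
have p0 : 0 < p by rewrite (lt_le_trans ltr01).
apply: poweR_lty.
have -> : (\int[@lebesgue2 R]_x (`|(fD x)%:E| `^ p))%E =
          (\int[@lebesgue2 R]_(x in @unit_square R) (`|f x| `^ p)%:E)%E.
  rewrite [RHS]integral_mkcond; apply: eq_integral => z _.
  rewrite /fD !patchE; case: ifP => _ //=.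
  by rewrite normr0 powR0// gt_eqF.
apply: (@le_lt_trans _ _ (\int[@lebesgue2 R]_(x in @unit_square R) (C `^ p)%:E)%E).
  apply: ge0_le_integral => //.
  - apply/measurable_EFinP/(@measurableT_comp _ _ _ _ _ _ (@powR R ^~ p)) => //.
    by apply: measurableT_comp => //; exact: measurable_funTS.
  - by move=> z _; rewrite lee_fin ge0_ler_powR// ?nnegrE// ltW.
rewrite integral_cst// /unit_square [X in (_ * X)%E]lebesgue2X; [|exact: measurable_itv..].
rewrite -ge0_fin_numE ?mule_ge0 ?measure_ge0 ?lee_fin ?powR_ge0//.
by rewrite !fin_numM// lebesgue_unit_fin//; exact: measurable_itv.
Qed.

(** * The cut norm of the symmetric kernel *)

(** One dyadic interval.  The arguments are the masses of two sets in its left (0)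
and right (1) halves.  After the antisymmetric product is rewritten in terms
of the differences x1 - x0 and y1 - y0, each difference d contributes at most
|d| / 4, which is split as t l / 4 + d^2 / (4 t l): the first term is paid once
per level, the second is absorbed by the energy. *)
Lemma cross_le (R : realType) (t l x0 x1 y0 y1 : R) : 0 < t -> 0 < l ->
  0 <= x0 <= l / 4 -> 0 <= x1 <= l / 4 -> 0 <= y0 <= l / 4 -> 0 <= y1 <= l / 4 ->
  `|l^-1 * (x0 * y1 - x1 * y0)| <=
  t * l / 2 + ((x1 - x0) ^+ 2 + (y1 - y0) ^+ 2) / (4 * t * l).
Proof.
move=> t0 l0 /andP[x00 x0l] /andP[x10 x1l] /andP[y00 y0l] /andP[y10 y1l].
have young d : `|d| / 4 <= t * l / 4 + d ^+ 2 / (4 * t * l).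
  rewrite -subr_ge0 -(@pmulr_rge0 _ (4 * t * l)) ?mulr_gt0//.
  have -> : 4 * t * l * (t * l / 4 + d ^+ 2 / (4 * t * l) - `|d| / 4) =
            (t * l - `|d|) ^+ 2 + `|d| * t * l.
    by rewrite sqrrB real_normK ?num_real//; field; rewrite !gt_eqF.
  by rewrite addr_ge0 ?sqr_ge0// !mulr_ge0// ltW.
have -> : x0 * y1 - x1 * y0 =
    ((x0 + x1) * (y1 - y0) - (x1 - x0) * (y0 + y1)) / 2 by field.
have split_le : `|l^-1 * (((x0 + x1) * (y1 - y0) - (x1 - x0) * (y0 + y1)) / 2)|
    <= `|x1 - x0| / 4 + `|y1 - y0| / 4.
  rewrite normrM gtr0_norm ?invr_gt0// mulrC ler_pdivrMr//.
  rewrite normrM (@ger0_norm _ 2^-1) ?invr_ge0// ler_pdivrMr//.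
  rewrite (le_trans (ler_normB _ _))// !normrM.
  rewrite (@ger0_norm _ (x0 + x1)) ?(@ger0_norm _ (y0 + y1)) ?addr_ge0//.
  have := normr_ge0 (x1 - x0); have := normr_ge0 (y1 - y0).
  move: `|x1 - x0| `|y1 - y0| => a b b0 a0.
  have xb : 0 <= (l / 2 - (x0 + x1)) * b by rewrite mulr_ge0//; lra.
  have ya : 0 <= (l / 2 - (y0 + y1)) * a by rewrite mulr_ge0//; lra.
  lra.
have yx := young (x1 - x0); have yy := young (y1 - y0).
by rewrite (le_trans split_le)// [X in _ <= _ + X]mulrDl; lra.
Qed.

(** What the bound needs to know about the measure of the intersection with S:
density at most 1 on each colour, additivity over the two halves. *)
Definition comb_density {R : realType} (f : set R -> R) :=
  (forall b n a l, 0 <= l -> 0 <= f (comb b n a l) <= l / 2) /\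
  (forall b n a l, 0 <= l -> f (comb b n.+1 a l) =
     f (comb b n a (l / 2)) + f (comb b n (a + l / 2) (l / 2))).

(** Normalised so that passing to the two halves of an interval raises the total
energy by exactly the squared differences, divided by l, that appear in
[cross_le]. *)
Definition energy {R : realType} n (a l : R) (f : set R -> R) : R :=
  (f (comb false n a l) ^+ 2 + f (comb true n a l) ^+ 2) / l.

(** Induction on the number of levels.  The density bound keeps the two energies
together at most l, so the last term is a nonnegative reserve; by the
parallelogram identity the reserve lost at each level is exactly what
[cross_le] asks for. *)
Lemma rect_form_upper_le (R : realType) (f g : set R -> R) (t : R) n (a l : R) :
  comb_density f -> comb_density g -> 0 < t -> 0 < l ->
  `|rect_form (upper n a l) f g + rect_form (upper n a l) g f| <=
  t * n%:R * l + (l - energy n a l f - energy n a l g) / (4 * t).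
Proof.
move=> [f_le fD] [g_le gD] t0; elim: n a l => [|n IH] a l l0.
  rewrite /rect_form !big_nil addr0 normr0 mulr0 mul0r add0r.
  have energy_le h : (forall b n a l, 0 <= l -> 0 <= h (comb b n a l) <= l / 2) ->
      energy 0%N a l h <= l / 2.
    move=> h_le; rewrite /energy ler_pdivrMr//.
    have sqr_le b : h (comb b 0%N a l) ^+ 2 <= (l / 2) ^+ 2.
      have /andP[h0 hl] := h_le b 0%N a _ (ltW l0).
      by rewrite ler_pXn2r// nnegrE (le_trans h0).
    rewrite (le_trans (lerD (sqr_le false) (sqr_le true)))//.
    by rewrite le_eqVlt; apply/orP; left; apply/eqP; field.
  have := energy_le _ f_le; have := energy_le _ g_le => gl fl.
  by apply: divr_ge0; [lra|rewrite mulr_ge0// ltW].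
have l20 : 0 < l / 2 by lra.
have IHl := IH a _ l20; have IHr := IH (a + l / 2) _ l20.
have quarter h b c : (forall b n a l, 0 <= l -> 0 <= h (comb b n a l) <= l / 2) ->
    0 <= h (comb b n c (l / 2)) <= l / 4.
  by move=> /(_ b n c _ (ltW l20)); rewrite -mulrA -invfM -natrM.
have cross_fg := cross_le _ _ _ _ _ _ _ t0 l0 (quarter f false a f_le)
  (quarter f false (a + l / 2) f_le) (quarter g true a g_le)
  (quarter g true (a + l / 2) g_le).
have cross_gf := cross_le _ _ _ _ _ _ _ t0 l0 (quarter g false a g_le)
  (quarter g false (a + l / 2) g_le) (quarter f true a f_le)
  (quarter f true (a + l / 2) f_le).
(* The parallelogram identity, for each of the two colours. *)
have energy_split h :
    (forall b n a l, 0 <= l -> h (comb b n.+1 a l) =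
      h (comb b n a (l / 2)) + h (comb b n (a + l / 2) (l / 2))) ->
    energy n.+1 a l h =
      energy n a (l / 2) h + energy n (a + l / 2) (l / 2) h -
      ((h (comb false n (a + l / 2) (l / 2)) - h (comb false n a (l / 2))) ^+ 2 +
       (h (comb true n (a + l / 2) (l / 2)) - h (comb true n a (l / 2))) ^+ 2) / l.
  move=> hD; rewrite /energy (hD _ _ _ _ (ltW l0)) (hD _ _ _ _ (ltW l0)).
  by field; rewrite gt_eqF.
rewrite (energy_split _ fD) (energy_split _ gD) /= !rect_form_cat.
(* Occurrences 3 and 6 are the forms of the rectangles of the current level. *)
rewrite {3 6}/rect_form !big_cons !big_nil /=.
move: IHl IHr cross_fg cross_gf.
set A := rect_form _ f g + _; set B := rect_form _ f g + _.
set C := l^-1 * _; set D := l^-1 * _ => hA hB hC hD.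
(* The four new rectangles pair up into two antisymmetric products: colour E
   for f against O for g, and the same with f and g exchanged. *)
rewrite [leLHS](_ : _ = `|A + B + C + D|); last first.
  by congr Num.norm; rewrite /A /B /C /D; ring.
apply: le_trans (ler_normD _ _) _.
apply: le_trans (lerD (ler_normD _ _) (lexx _)) _.
apply: le_trans (lerD (lerD (ler_normD _ _) (lexx _)) (lexx _)) _.
apply: le_trans (lerD (lerD (lerD hA hB) hC) hD) _.
rewrite le_eqVlt; apply/orP; left; apply/eqP.
by rewrite -[n.+1]addn1 natrD; field; rewrite !gt_eqF.
Qed.

Lemma mass_in_comb_density (R : realType) (S : set (measurableTypeR R)) :
  measurable S -> comb_density (mass_in S).
Proof.
move=> mS; have fin_comb b n a l : 0 <= l ->
    @lebesgue_measure R (comb b n a l `&` S) \is a fin_num.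
  move=> l0; rewrite ge0_fin_numE ?measure_ge0//.
  apply: (@le_lt_trans _ _ (@lebesgue_measure R (comb b n a l))).
    apply: le_measure; rewrite ?inE; last exact: subIsetl.
      by apply: measurableI => //; exact: comb_measurable.
    exact: comb_measurable.
  by rewrite comb_measure// ltry.
split=> b n a l l0.
  rewrite /mass_in fine_ge0 ?measure_ge0//= -lee_fin fineK ?fin_comb//.
  rewrite -(comb_measure _ b n a)//.
  apply: le_measure; rewrite ?inE; last exact: subIsetl.
    by apply: measurableI => //; exact: comb_measurable.
  exact: comb_measurable.
have l20 : 0 <= l / 2 by lra.
rewrite /mass_in /= setIUl measureU.
- by rewrite fineD//; exact: fin_comb.
- by apply: measurableI => //; exact: comb_measurable.
- by apply: measurableI => //; exact: comb_measurable.
- by rewrite setIACA comb_halves_disjoint// set0I.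
Qed.

(** * The cut norm after the triangular cut *)

(** On E x O only the rectangle with weight l^-1 of each interval survives; it
contributes l^-1 (l / 4)^2 = l / 16, and the lengths of the intervals of one
level add up to l. *)
Lemma rect_form_upper_comb (R : realType) (S T : set R) n (a l : R) : 0 < l ->
  comb false n a l `<=` S -> comb true n a l `&` S = set0 ->
  comb true n a l `<=` T ->
  rect_form (upper n a l) (mass_in S) (mass_in T) = n%:R * l / 16.
Proof.
elim: n a l => [|n IH] a l l0 SE SO TO; first by rewrite /rect_form big_nil !mul0r.
have l20 : 0 < l / 2 by lra.
have /= [SE0 SE1] : comb false n a (l / 2) `<=` S /\
    comb false n (a + l / 2) (l / 2) `<=` S.
  by split=> x Ex; apply: SE; [left|right].
have [TO0 TO1] : comb true n a (l / 2) `<=` T /\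
    comb true n (a + l / 2) (l / 2) `<=` T.
  by split=> x Ex; apply: TO; [left|right].
have [SO0 SO1] : comb true n a (l / 2) `&` S = set0 /\
    comb true n (a + l / 2) (l / 2) `&` S = set0.
  by move: SO => /=; rewrite setIUl setU_eq0.
rewrite /= !rect_form_cat !IH// /rect_form !big_cons big_nil /= /mass_in.
rewrite SO0 measure0 (setIidl SE0) (setIidl TO1) !comb_measure ?ltW//=.
by rewrite -[n.+1]addn1 natrD; field; rewrite gt_eqF.
Qed.

(** The bound of [rect_form_upper_le] at l = 1 is t n + 1 / (4 t), smallest in
order of magnitude at t = n^-1/2; taking n = m^2 and t = 1 / m avoids square
roots and gives at most 2 m, which is the normalisation k. *)
Lemma unbounded_graphon (R : realType) (r : R) : exists w : R * R -> R,
  [/\ forall p : \bar R, (1 <= p)%E -> graphon p w, (cutnorm w <= 1)%E &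
      (r%:E <= cutnorm (triangular_cut w))%E].
Proof.
(* After normalisation the cut kernel has cut norm at least m / 32. *)
pose m := (Num.truncn (32 * `|r|)).+1.
have m_gt : 32 * `|r| < m%:R by exact: truncnS_gt.
have m0 : 0 < m%:R :> R by rewrite ltr0n.
pose n := (m * m)%N; pose k : R := (2 * m%:R)^-1.
have k0 : 0 < k by rewrite invr_gt0 mulr_gt0.
pose U := upper n (0 : R) 1.
have mU : measurable_rects U by exact: upper_measurable.
have mW : measurable_rects (U ++ transpose U).
  by move=> u; rewrite mem_cat => /orP[/mU//|/mapP[v /mU[mA mB] ->]].
pose w z := k * rect_sum (U ++ transpose U) z.
have comb01 b : comb b n (0 : R) 1 `<=` `[0, 1].
  move=> x /(comb_sub _ _ _ _ _ ler01) /=; rewrite !in_itv/= add0r.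
  by move=> /andP[-> /ltW].
exists w; split.
- move=> p p1; have [C sC] := rect_sum_bounded _ (U ++ transpose U).
  apply: (bounded_graphon _ _ _ (k * C)) => //.
  + by apply: measurable_funM => //; exact: rect_sum_measurable.
  + by move=> z; rewrite normrM gtr0_norm// ler_wpM2l// ltW.
  + by move=> x y; rewrite /w !rect_sum_symmetrized [in RHS]addrC.
- apply: ge_ereal_sup => _ [S [T [mS mT S01 T01 ->]]].
  rewrite rect_sum_integral// lee_fin normrM gtr0_norm// rect_form_symmetrized.
  rewrite mulrC ler_pdivrMr ?mulr_gt0// mul1r.
  have minv0 : 0 < m%:R^-1 :> R by rewrite invr_gt0.
  have := rect_form_upper_le _ _ _ _ n 0 1 (mass_in_comb_density _ _ mS)
    (mass_in_comb_density _ _ mT) minv0 ltr01.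
  move=> /le_trans; apply.
  have energy_ge0 f : 0 <= energy n (0 : R) 1 f.
    by rewrite divr_ge0// addr_ge0// sqr_ge0.
  have : m%:R^-1 * n%:R * 1 = m%:R :> R.
    by rewrite /n natrM; field; rewrite gt_eqF.
  move=> ->.
  rewrite invfM invrK.
  have := energy_ge0 (mass_in S); have := energy_ge0 (mass_in T).
  move: (energy _ _ _ (mass_in S)) (energy _ _ _ (mass_in T)) => x y y0 x0.
  have : (1 - x - y) * (4^-1 * m%:R) <= 4^-1 * m%:R.
    by apply: ler_piMl; [rewrite mulr_ge0// ltW|lra].
  lra.
- rewrite triangular_cut_upper//.
  apply: le_trans (ereal_sup_ubound _); last first.
    exists (comb false n 0 1), (comb true n 0 1).
    split; [exact: comb_measurable|exact: comb_measurable|exact: comb01|exact: comb01|].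
    reflexivity.
  rewrite rect_sum_integral//; [|exact: comb_measurable..].
  rewrite rect_form_upper_comb//; last by rewrite setIC comb_colours_disjoint.
  rewrite lee_fin mulr1 ger0_norm; last by rewrite !mulr_ge0// ltW.
  have -> : k * (n%:R / 16) = m%:R / 32.
    by rewrite /k /n natrM; field; rewrite gt_eqF.
  rewrite ler_pdivlMr//.
  by have := ler_norm r; lra.
Qed.

Lemma oprnorm_triangular_cut (R : realType) (p : \bar R) : (1 <= p)%E ->
  oprnorm (graphon p) (@cutnorm R) (@triangular_cut R) = +oo%E.
Proof.
move=> p1; apply/eqyP => r _.
have [w [wp w1 wr]] := unbounded_graphon _ r.
by apply: le_trans wr _; apply: ereal_sup_ubound; exists w => //; split=> //; exact: wp.
Qed.

Theorem corollary3p4 (R : realType) :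
  [/\ forall c : R, 0 < c ->
        exists w : R * R -> R, graphon +oo%E w /\
          (c%:E * cutnorm w < cutnorm (triangular_cut w))%E,
      oprnorm (graphon +oo%E) (@cutnorm R) (@triangular_cut R) = +oo%E &
      forall p : R, 1 <= p ->
        oprnorm (graphon p%:E) (@cutnorm R) (@triangular_cut R) = +oo%E].
Proof.
split=> [c c0||p p1].
- have [w [wp w1 wr]] := unbounded_graphon _ (c + 1).
  exists w; split; first by apply: wp; rewrite leey.
  apply: lt_le_trans wr; apply: (@le_lt_trans _ _ c%:E).
    by rewrite -[leRHS]mule1 lee_wpmul2l// lee_fin ltW.
  by rewrite lte_fin ltrDl.
- by apply: oprnorm_triangular_cut; rewrite leey.
- by apply: oprnorm_triangular_cut; rewrite lee_fin.
Qed.
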